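(* For each real number $u \geq 2$ define the closed set $X_u \subset \mathbb{R}$ and the open set $X_u^\circ \subset \mathbb{R}$ by $$X_u := \bigcup_{n=1}^\infty \left[2^{u^n},\, 2^{u^n} + u^n\right] \quad\text{and}\quad X_u^\circ := \bigcup_{n=1}^\infty \left]2^{u^n},\, 2^{u^n} + u^n\right[.$$ If $v, w$ are real numbers with $2 \leq v < w$, then there is no uniformly continuous bijection from $X_v$ onto $X_w$, and there is no uniformly continuous bijection from $X_v^\circ$ onto $X_w^\circ$.
   Context: $]a,b[$ denotes the open interval with endpoints $a<b$. All subsets of $\mathbb{R}$ are equipped with the Euclidean metric. $2^{u^n}$ means $2^{(u^n)}$. *)

(* Defs.v *)
From mathcomp Require Import all_boot all_order all_algebra.
From mathcomp Require Import all_classical all_reals all_analysis.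
Import Order.TTheory GRing.Theory Num.Theory.
Import numFieldNormedType.Exports.

Set Implicit Arguments.
Unset Strict Implicit.
Unset Printing Implicit Defensive.

Local Open Scope classical_set_scope.
Local Open Scope ring_scope.

Definition Xc (R : realType) (u : R) : set R :=
  \bigcup_(n >= 1) `[2 `^ (u ^+ n), 2 `^ (u ^+ n) + u ^+ n]%classic.

Definition Xo (R : realType) (u : R) : set R :=
  \bigcup_(n >= 1) `]2 `^ (u ^+ n), 2 `^ (u ^+ n) + u ^+ n[%classic.

(* A map A -> B is the restriction to A of some total f : R -> R with
   f(A) `<=` B.  The uniformity of [subspace A] is that of A on A and discrete
   elsewhere, so only the values of f on A matter. *)
Definition unif_continuous_bij (R : realType) (A B : set R) (f : R -> R) :=
  set_bij A B f /\ unif_continuous (from_subspace A f).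

(* Main.v *)
(* Each component of X_v is mapped onto a component of X_w: the images of the
   components partition X_w into intervals that are all compact (resp. all open),
   and such a partition is unique, by Sierpinski's theorem that a segment is not a
   countable disjoint union of at least two nonempty closed sets (resp. by
   connectedness). This gives an injection s of the indices; uniform continuity
   stretches lengths at most affinely at large scale, so w^(s n) <= C v^n + C'.
   By the pigeonhole principle s n >= N for some n <= N, hence
   w^N <= C v^N + C' for all N, which is absurd. *)
Require Import Defs.
From mathcomp Require Import all_boot all_order all_algebra.
From mathcomp Require Import all_classical all_reals all_analysis.
From mathcomp Require Import ring lra.
Import Order.TTheory GRing.Theory Num.Theory.
Import numFieldNormedType.Exports.

Local Open Scope classical_set_scope.
Local Open Scope ring_scope.

(** * Segments covered by disjoint closed sets or by disjoint open sets *)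

(** Shrinking step for Sierpinski's theorem. The last point [c] of [C] in the segment is not in [D],
    so [c < t], and points just right of [c] still miss [D] because [D] is closed. If [C] misses the
    segment, [s] itself serves. *)
Lemma closed_avoid_right {R : realType} {C D : set R} {s t : R} :
  closed C -> closed D -> C `&` D = set0 -> s < t -> ~ D s -> D t ->
  exists2 s', s <= s' < t & ~ D s' /\ (forall x, s' <= x <= t -> ~ C x).
Proof.
move=> cC cD CD0 st nDs Dt.
have disj x : C x -> D x -> False by move=> Cx Dx; rewrite -[False]/(set0 x) -CD0.
pose E := C `&` `[s, t]%classic.
have [Cst|E0] := pselect (E !=set0); last first.
  exists s; first by rewrite lexx.
  split=> // x xst Cx; apply: E0; exists x; split=> //=.
have ubE : has_ubound E by exists t => x [_]; rewrite /= in_itv => /andP[].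
have [Cc] : E (sup E).
  have cE : closed E by apply: closedI => //; exact: itv_closed.
  by rewrite [E in E _](iffLR (closure_id E) cE); exact: closure_sup.
rewrite /= in_itv /=; set c := sup E => /andP[sc ct].
have {}ct : c < t.
  by rewrite lt_neqAle ct andbT; apply/eqP => ctE; apply: (disj c) => //; rewrite ctE.
have [s' [cs' s't] nDs'] : exists2 s', c < s' /\ s' < t & ~ D s'.
  have /nbhs_ballP[e /= e0 be] : nbhs c (~` D).
    by apply: open_nbhs_nbhs; split; [rewrite openC|move=> /(disj c)].
  pose m := Num.min e (t - c); have m0 : 0 < m by rewrite lt_min e0 subr_gt0.
  have [me mt] : m <= e /\ m <= t - c by split; rewrite ge_min lexx ?orbT.
  exists (c + m / 2); first by split; lra.
  by apply: be; rewrite /ball/= ltr_distlC; apply/andP; split; lra.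
exists s'; first by rewrite s't andbT (le_trans sc)// ltW.
split=> // x /andP[s'x xt] Cx.
have : x <= c.
  apply: ub_le_sup => //; split=> //=; rewrite in_itv/= xt andbT.
  by rewrite (le_trans sc)// (le_trans (ltW cs')).
by rewrite leNgt (lt_le_trans cs').
Qed.

(** Mirror image of the previous lemma under negation. *)
Lemma closed_avoid_left {R : realType} {C D : set R} {s t : R} :
  closed C -> closed D -> C `&` D = set0 -> s < t -> D s -> ~ D t ->
  exists2 t', s < t' <= t & ~ D t' /\ (forall x, s <= x <= t' -> ~ C x).
Proof.
move=> cC cD CD0 st Ds nDt.
have cN (E : set R) : closed E -> closed (-%R @^-1` E).
  by move=> cE; apply: preimage_closed => // x _; exact: opp_continuous.
have [||||s' /andP[ts' s's] [nDs' avC]] :=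
  @closed_avoid_right _ _ _ (- t) (- s) (cN _ cC) (cN _ cD).
- by rewrite -preimage_setI CD0 preimage_set0.
- by rewrite ltrN2.
- by rewrite /preimage/= opprK.
- by rewrite /preimage/= opprK.
exists (- s'); first by rewrite ltrNr s's lerNl.
split=> // x /andP[sx xs'] Cx; apply: (avC (- x)); last by rewrite /preimage/= opprK.
by rewrite lerNr xs' lerN2.
Qed.

(* Sierpinski: nested segments with endpoints in different classes, the n-th of
   which avoids [K n]. *)
Lemma closed_trivIset_cover_segment {R : realType} {K : nat -> set R} {s t : R} :
  (forall k, closed (K k)) -> trivIset setT K ->
  s <= t -> `[s, t]%classic `<=` \bigcup_k K k -> exists k, K k s /\ K k t.
Proof.
move=> cK tK st Kst; apply: contrapT => Nst.
have disj i j x : K i x -> K j x -> i = j.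
  by move=> Ki Kj; apply: tK => //; exists x.
have disj0 i j : i <> j -> K i `&` K j = set0.
  by move=> ij; rewrite -subset0 => x [/disj+ /[dup]+]; move=> /[apply].
have memK x : s <= x <= t -> exists k, K k x.
  by move=> xst; have [|k _] := Kst x; [rewrite /= in_itv|exists k].
pose P (p : R * R) :=
  [/\ s <= p.1, p.1 < p.2, p.2 <= t & ~ exists k, K k p.1 /\ K k p.2].
(* The invariant [P] is a premise inside the result, so [step] is total and can be iterated before
   [P] is known along the sequence. *)
have step (np : nat * (R * R)) : { q : R * R | P np.2 ->
  [/\ P q, np.2.1 <= q.1, q.2 <= np.2.2 &
      forall x, q.1 <= x <= q.2 -> ~ K np.1 x]}.
  case: np => n [a b]; apply: cid => /=.
  have [Pab|] := pselect (P (a, b)); last by exists (a, b).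
  case: (Pab) => /= sa ab bt Nab.
  have [i Kia] : exists i, K i a by apply: memK; rewrite sa (le_trans (ltW ab)).
  have [j Kjb] : exists j, K j b by apply: memK; rewrite bt (le_trans sa)// ltW.
  (* If [b] is not in [K n], the left end moves right, past [K n] and out of the class of [b].
     Otherwise [a] is not in [K n], and the right end moves left. *)
  have [jn|/disj0 njn] := pselect (j = n); last first.
    have [||s' /andP[as' s'b] [Ks' av]] :=
      @closed_avoid_right _ (K n) (K j) a b (cK n) (cK j) _ ab _ Kjb.
    - by rewrite setIC.
    - by move=> Kja; apply: Nab; exists j.
    exists (s', b) => _; split => //; split => //=; first exact: le_trans as'.
    by move=> [k [Kks' Kkb]]; apply: Ks'; rewrite (disj j k b).
  have nin : n <> i by move=> ni; apply: Nab; exists i; split=> //; rewrite -ni -jn.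
  have [|t' /andP[at' t'b] [Kt' av]] :=
      @closed_avoid_left _ (K n) (K i) a b (cK n) (cK i) (disj0 _ _ nin) ab Kia.
    by move=> Kib; apply: Nab; exists i.
  exists (a, t') => _; split => //; split => //=; first exact: le_trans bt.
  by move=> [k [Kka Kkt']]; apply: Kt'; rewrite (disj i k a).
pose g n := nat_rect (fun=> R * R)%type (s, t) (fun n p => sval (step (n, p))) n.
have Pg n : P (g n).
  elim: n => [|n IH] /=; last by case: (step (n, g n)) => q /= /(_ IH)[].
  split=> //=; rewrite lt_neqAle st andbT; apply/eqP => stE; apply: Nst.
  have [|k Kk] := memK s; first by rewrite lexx.
  by exists k; rewrite -stE.
have gS n : [/\ (g n).1 <= (g n.+1).1, (g n.+1).2 <= (g n).2 &
    forall x, (g n.+1).1 <= x <= (g n.+1).2 -> ~ K n x].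
  by move=> /=; case: (step (n, g n)) => q /= /(_ (Pg n))[].
have g1 : {homo (fun n => (g n).1) : m n / (m <= n)%N >-> m <= n}.
  by apply: homo_leq => // [x y z|n]; [exact: le_trans|case: (gS n)].
have g2 : {homo (fun n => (g n).2) : m n / (m <= n)%N >-> n <= m}.
  by apply: homo_leq => // [x y z ? /le_trans|n]; [exact|case: (gS n)].
have g12 m n : (g m).1 <= (g n).2.
  have [/g1 mn|/ltnW/g2 nm] := leqP m n.
    by apply: (le_trans mn); case: (Pg n) => _ /ltW.
  by apply: le_trans nm; case: (Pg m) => _ /ltW.
(* A point common to all the segments: its class [K k] contradicts stage [k.+1], which avoids
   [K k]. *)
pose x := sup (range (fun n => (g n).1)).
have xg n : (g n).1 <= x <= (g n).2.
  apply/andP; split.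
    by apply: ub_le_sup; [exists t => _ [m _ <-]; exact: (g12 m 0%N)|exists n].
  by apply: ge_sup; [exists (g 0%N).1, 0%N|move=> _ [m _ <-]].
have [k Kkx] := memK x (xg 0%N).
by case: (gS k) => _ _ /(_ x (xg k.+1)).
Qed.

(** The class of [s] is relatively clopen in the segment, its complement there being covered by the
    other open classes; connectedness makes it the whole segment. *)
Lemma open_trivIset_cover_segment {R : realType} {K : nat -> set R} {s t : R} :
  (forall k, open (K k)) -> trivIset setT K ->
  s <= t -> `[s, t]%classic `<=` \bigcup_k K k -> exists k, K k s /\ K k t.
Proof.
move=> oK tK st Kst.
have [|k _ Kks] := Kst s; first by rewrite /= in_itv/= lexx.
exists k; split=> //.
suff E : `[s, t]%classic `&` K k = `[s, t]%classic.
  have : `[s, t]%classic t by rewrite /= in_itv/= lexx andbT.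
  by rewrite -E => -[].
apply: (@segment_connected _ s t).
- by exists s; split=> //=; rewrite in_itv/= lexx.
- by exists (K k).
exists (~` \bigcup_(i in [set i | i <> k]) K i).
  by rewrite closedC; apply: bigcup_open.
apply/seteqP; split=> x [xst].
  move=> Kkx; split=> // -[i /= ik Kix]; apply: ik.
  by apply: tK => //; exists x.
move=> nK; split=> //; have [i _ Kix] := Kst x xst.
have [<-//|ik] := pselect (i = k).
by exfalso; apply: nK; exists i.
Qed.

(** * Continuous and uniformly continuous maps on subsets of the line *)

Lemma unif_continuous_subspaceP {R : realType} {A : set R} {f : R -> R} :
  unif_continuous (from_subspace A f) -> forall e, 0 < e ->
  exists2 d, 0 < d & forall x y, A x -> A y -> `|x - y| < d -> `|f x - f y| < e.
Proof.
move=> /unif_continuousP fu e /fu[d d0 fd]; exists d => // x y Ax Ay xyd.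
have := fd (x, y); rewrite ball_subspace_ball /subspace_ball /= mem_set//.
by apply; split.
Qed.

Lemma unif_continuous_within {R : realType} {A : set R} {f : R -> R} :
  unif_continuous (from_subspace A f) -> {within A, continuous f}.
Proof.
move=> fu; apply/subspace_continuousP => x Ax; apply/cvgrPdist_lt => e e0.
have [d d0 fd] := unif_continuous_subspaceP fu e e0.
apply/nbhs_ballP; exists d => //= y.
by rewrite /ball/= => xyd Ay; exact: fd.
Qed.

(** One-dimensional invariance of domain: [f] is strictly monotone, so [f x] lies strictly between
    the values at two points around [x], and the image is an interval. *)
Lemma continuous_inj_image_open {R : realType} {a b : R} {f : R -> R} :
  {within `]a, b[, continuous f} -> set_inj `]a, b[ f -> open (f @` `]a, b[).
Proof.
move=> cf injf; rewrite openE => _ [x xab <-]; rewrite /interior.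
have [ax xb] : a < x /\ x < b by move: xab; rewrite /= in_itv /= => /andP[].
pose c := (a + x) / 2; pose d := (x + b) / 2.
have fi : is_interval (f @` `]a, b[).
  apply/connected_intervalP/connected_continuous_connected => //.
  exact/connected_intervalP/interval_is_interval.
have cab : `]a, b[%classic c by rewrite /= in_itv/= /c; apply/andP; split; lra.
have dab : `]a, b[%classic d by rewrite /= in_itv/= /d; apply/andP; split; lra.
have sub (y z : R) : (f @` `]a, b[) y -> (f @` `]a, b[) z ->  
    y < f x < z -> nbhs (f x) (f @` `]a, b[).
  move=> fy fz yxz; suff: \forall u \near f x, u \in `]y, z[.
    apply: filterS => u; rewrite in_itv/= => /andP[yu uz].
    by apply: (fi _ _ fy fz); rewrite !ltW.
  by apply: near_in_itvoo; rewrite in_itv.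
have injf' : {in `]a, b[%R &, injective f}.
  by move=> y z yab zab; apply: injf; rewrite inE.
have [H|H] := itv_continuous_inj_mono cf injf'.
  apply: (sub (f c) (f d)); [by exists c|by exists d|].
  by rewrite !H// /c /d; lra.
apply: (sub (f d) (f c)); [by exists d|by exists c|].
by rewrite !H// /c /d; lra.
Qed.

(** Walk from [x] to [y] inside [I] in equal steps of length at most [d / 2]. Each changes [f] by
    less than 1, and one more than the integer part of [2 / d * |x - y|] steps suffice. *)
Lemma is_interval_lipschitz_large {R : realType} {I : set R} {f : R -> R} {d : R} :
  is_interval I -> 0 < d ->
  (forall x y, I x -> I y -> `|x - y| < d -> `|f x - f y| < 1) ->
  forall x y, I x -> I y -> `|f x - f y| <= 2 / d * `|x - y| + 1.
Proof.
move=> Ii d0 fd.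
have chain k : forall x y, I x -> I y -> `|x - y| <= k%:R * (d / 2) ->
    `|f x - f y| <= k%:R.
  elim: k => [|k IH] x y Ix Iy.
    by rewrite mul0r normr_le0 subr_eq0 => /eqP ->; rewrite subrr normr0.
  (* [z] is the last stop before [y]: the induction hypothesis covers the [k] steps from [x] to
     [z]. *)
  move=> xyk; pose r : R := k%:R / k.+1%:R; pose z := x + (y - x) * r.
  have r01 : 0 <= r <= 1.
    by rewrite divr_ge0//= ler_pdivrMr ?ltr0n// mul1r ler_nat.
  have Iz : I z.
    have /orP[xy|xy] := le_total x y.
      by apply: (Ii x y) => //; rewrite /z; apply/andP; split; nra.
    by apply: (Ii y x) => //; rewrite /z; apply/andP; split; nra.
  have k0 : (0 : R) < k.+1%:R by rewrite ltr0n.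
  have fxz : `|f x - f z| <= k%:R.
    apply: IH => //; rewrite /z opprD addNKr normrN normrM distrC.
    rewrite (ger0_norm (_ : 0 <= r)); last by case/andP: r01.
    rewrite /r [leLHS]mulrA ler_pdivrMr// [leLHS]mulrC -mulrA ler_wpM2l//.
    by rewrite mulrC.
  have fzy : `|f z - f y| < 1.
    apply: fd => //; have -> : z - y = (x - y) / k.+1%:R.
      rewrite /z /r -(natr1 k); field; rewrite natr1; exact: lt0r_neq0.
    rewrite normrM normfV (gtr0_norm k0) ltr_pdivrMr// (le_lt_trans xyk)//.
    by rewrite mulrC ltr_pM2r//; lra.
  rewrite -(subrKA (f z)) (le_trans (ler_normD _ _))// -natr1 lerD//.
  exact: ltW.
move=> x y Ix Iy; set t := 2 / d * `|x - y|.
have t0 : 0 <= t by rewrite mulr_ge0// divr_ge0// ltW.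
have /andP[tt tS] := truncn_itv t0.
apply: (le_trans (chain (Num.truncn t).+1 x y Ix Iy _)); last first.
  by rewrite -natr1 lerD2r.
have -> : `|x - y| = t * (d / 2) by rewrite /t; field; exact: lt0r_neq0.
by rewrite ler_wpM2r ?divr_ge0// ltW.
Qed.

(** * The components of the two sets and their images *)

(* [b = true] gives the closed components, [b = false] the open ones. *)
Definition component {R : realType} (b : bool) (u : R) (n : nat) : set R :=
  [set` Interval (BSide b (2 `^ (u ^+ n)))
                 (BSide (~~ b) (2 `^ (u ^+ n) + u ^+ n))].

Lemma component_le {R : realType} {b : bool} {u : R} {n : nat} {x : R} :
  component b u n x -> 2 `^ (u ^+ n) <= x <= 2 `^ (u ^+ n) + u ^+ n.
Proof.
rewrite /component; case: b; rewrite /= in_itv //= => /andP[? ?].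
by rewrite !ltW.
Qed.

Lemma lt_component {R : realType} {b : bool} {u : R} {n : nat} {x : R} :
  2 `^ (u ^+ n) < x < 2 `^ (u ^+ n) + u ^+ n -> component b u n x.
Proof.
rewrite /component; case: b; rewrite /= in_itv //= => /andP[? ?].
by rewrite !ltW.
Qed.

(** With [a = 2 ^ t], the next left endpoint is [a ^ u >= a * a], while [a + t <= 3 * a - 2 < a * a]
    as [a >= 4]. *)
Lemma component_lt_next {R : realType} {u : R} (n : nat) : 2 <= u ->
  2 `^ (u ^+ n.+1) + u ^+ n.+1 < 2 `^ (u ^+ n.+2).
Proof.
move=> u2; set t := u ^+ n.+1; set a := 2 `^ t.
have u1 : 1 <= u by lra.
have t2 : 2 <= t by apply: (le_trans u2); rewrite -[leLHS]expr1 ler_weXn2l.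
have -> : 2 `^ (u ^+ n.+2) = a `^ u by rewrite exprSr powRrM.
have a4 : 4 <= a.
  have -> : 4 = 2 `^ 2%:R :> R by rewrite powR_mulrn// -natrX.
  by rewrite ler_powR// ler1n.
have aa : a * a <= a `^ u.
  have -> : a * a = a `^ 2%:R by rewrite powR_mulrn ?expr2//; lra.
  by rewrite ler_powR//; lra.
(* From [a = exp (t * ln 2) >= 1 + t * ln 2] and [ln 2 >= 1 / 2]. *)
have ta : t + 2 <= 2 * a.
  have ln2 : 1 / 2 <= ln 2 :> R.
    have : ln (1 + - (1 / 2)) <= - (1 / 2) :> R by apply: le_ln1Dx; lra.
    have -> : 1 + - (1 / 2) = 2^-1 :> R by field.
    by rewrite lnV ?posrE//; lra.
  have := expR_ge1Dx (t * ln 2).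
  rewrite (_ : expR (t * ln 2) = a); last by rewrite /a /powR gt_eqF.
  nra.
nra.
Qed.

Lemma component_trivIset {R : realType} (b : bool) {u : R} : 2 <= u ->
  trivIset setT (fun k => component b u k.+1).
Proof.
move=> u2; have u1 : 1 <= u by lra.
have lt m n x y : (m < n)%N ->
    component b u m.+1 x -> component b u n.+1 y -> x < y.
  move=> mn /component_le/andP[_ xR] /component_le/andP[yL _].
  apply: (le_lt_trans xR); apply: lt_le_trans yL.
  apply: (lt_le_trans (component_lt_next m u2)).
  by rewrite ler_powR ?ler1n// ler_weXn2l.
move=> m n _ _ [x [xm xn]]; have [mn|nm|//] := ltngtP m n.
  by have := lt _ _ _ _ mn xm xn; rewrite ltxx.
by have := lt _ _ _ _ nm xn xm; rewrite ltxx.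
Qed.

Definition closed_or_open {R : realType} (b : bool) (A : set R) : Prop :=
  if b then closed A else open A.

Lemma component_closed_or_open {R : realType} (b : bool) (u : R) (n : nat) :
  closed_or_open b (component b u n).
Proof. by case: b; [exact: itv_closed|exact: itv_open]. Qed.

(** Compactness of segments settles the closed case, invariance of domain the open one. *)
Lemma component_image_closed_or_open {R : realType} {b : bool} {u : R} {n : nat}
    {f : R -> R} :
  {within component b u n, continuous f} -> set_inj (component b u n) f ->
  closed_or_open b (f @` component b u n).
Proof.
case: b => cf injf /=; last exact: continuous_inj_image_open.
apply: compact_closed; first exact: Rhausdorff.
by apply: continuous_compact => //; exact: segment_compact.
Qed.

(** * Uniqueness of partitions into intervals *)

Lemma trivIset_interval_partition_unique {R : realType} {b : bool}
    {K J : nat -> set R} :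
  (forall k, closed_or_open b (K k)) -> (forall k, closed_or_open b (J k)) ->
  trivIset setT K -> trivIset setT J ->
  (forall k, is_interval (K k)) -> (forall k, is_interval (J k)) ->
  \bigcup_k K k = \bigcup_k J k ->
  forall k, K k !=set0 -> exists m, K k = J m.
Proof.
move=> bK bJ tK tJ iK iJ KJ k [x Kx].
have cover (A : nat -> set R) : (forall k, closed_or_open b (A k)) ->
    trivIset setT A -> forall s t, s <= t ->
    `[s, t]%classic `<=` \bigcup_k A k -> exists k, A k s /\ A k t.
  move=> bA tA s t; case: b {bK bJ} bA => bA; first exact: closed_trivIset_cover_segment.
  exact: open_trivIset_cover_segment.
(* The segment from [x] to [y] stays in [A i], hence is covered by the [B k], so one of them
   contains both ends; disjointness makes it [B j]. Used in both directions, this gives equality. *)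
have sub (A B : nat -> set R) : (forall k, closed_or_open b (B k)) ->
    trivIset setT B -> (forall k, is_interval (A k)) ->
    \bigcup_k A k `<=` \bigcup_k B k ->
    forall i j, A i x -> B j x -> A i `<=` B j.
  move=> bB tB iA AB i j Aix Bjx y Aiy.
  have segAB s t : A i s -> A i t -> `[s, t]%classic `<=` \bigcup_k B k.
    move=> As At z; rewrite /= in_itv/= => szt; apply: AB; exists i => //.
    exact: iA szt.
  have [l [Blx Bly]] : exists l, B l x /\ B l y.
    have [xy|/ltW yx] := leP x y; first exact: cover (segAB _ _ _ _).
    by have [l []] := cover _ bB tB _ _ yx (segAB _ _ Aiy Aix); exists l.
  by rewrite (tB j l)//; exists x.
have [m _ Jx] : (\bigcup_k J k) x by rewrite -KJ; exists k.
exists m; apply/seteqP; split; first by apply: sub => //; rewrite KJ.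
by apply: sub => //; rewrite KJ.
Qed.

(** * Comparison of growth rates and conclusion *)

Lemma injective_ge {g : nat -> nat} (N : nat) :
  injective g -> exists2 n, (n <= N)%N & (N <= g n)%N.
Proof.
move=> injg; apply: contrapT => H.
have gN (i : 'I_N.+1) : (g i < N)%N.
  by rewrite ltnNge; apply/negP => Ng; apply: H; exists i => //; rewrite -ltnS.
have /inj_leq : injective (fun i => Ordinal (gN i)).
  by move=> i j /(congr1 val)/= /injg/val_inj.
by rewrite ltnn.
Qed.

(** For [C > 0], the powers of [v / w] tend to 0 and so drop below [C^-1]. The exponent [n.+1]
    matches components numbered from 1. *)
Lemma exprn_dominates {R : realType} {v w : R} (C : R) : 0 < v -> v < w ->
  exists n, C * v ^+ n.+1 < w ^+ n.+1.
Proof.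
move=> v0 vw; have w0 : 0 < w by exact: lt_trans vw.
have [C0|C0] := leP C 0.
  exists 0%N; apply: (@le_lt_trans _ _ 0); last by rewrite exprn_gt0.
  by rewrite mulr_le0_ge0// exprn_ge0// ltW.
have q1 : `|v / w| < 1 by rewrite gtr0_norm ?divr_gt0// ltr_pdivrMr// mul1r.
have /cvgrPdist_lt/(_ C^-1) := cvg_expr q1; rewrite invr_gt0 => /(_ C0)[N _ HN].
exists N; have := HN N.+1 (leqnSn N).
rewrite /= sub0r normrN ger0_norm ?exprn_ge0 ?divr_ge0// ?ltW//.
by rewrite exprMn exprVn ltr_pdivrMr ?exprn_gt0// mulrC ltr_pdivlMr// mulrC.
Qed.

Lemma no_unif_continuous_bij {R : realType} (b : bool) {v w : R} (f : R -> R) :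
  2 <= v -> v < w ->
  ~ unif_continuous_bij (\bigcup_k component b v k.+1)
                        (\bigcup_k component b w k.+1) f.
Proof.
move=> v2 vw [[funf injf surjf] fu].
set X := \bigcup_k _ in funf injf surjf fu.
have cf := unif_continuous_within fu.
have [d d0 fd] := unif_continuous_subspaceP fu 1 ltr01.
have w2 : 2 <= w by lra.
have C0 : 0 < 2 / d by rewrite divr_gt0.
have subX k : component b v k.+1 `<=` X by move=> x Ix; exists k.
have cfk k : {within component b v k.+1, continuous f}.
  exact: continuous_subspaceW (subX k) cf.
have injfk k : set_inj (component b v k.+1) f.
  by move=> x y; rewrite !inE => Ix Iy; apply: injf; rewrite inE; exact: (subX k).
pose K k := f @` component b v k.+1.
have tK : trivIset setT K.
  move=> i j _ _ [_ [[x xi <-] [y yj fyx]]].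
  have xy : y = x by apply: injf => //; rewrite inE; [exact: subX yj|exact: subX xi].
  by apply: (component_trivIset b v2) => //; exists x; split=> //; rewrite -xy.
have KX : \bigcup_k K k = \bigcup_k component b w k.+1.
  apply/seteqP; split=> [_ [k _ [x Ix <-]]|y /surjf[x [k _ Ix] <-]].
    by apply: funf; exact: subX Ix.
  by exists k => //; exists x.
have K0 k : K k !=set0.
  have v0 : 0 < v ^+ k.+1 by rewrite exprn_gt0//; lra.
  exists (f (2 `^ (v ^+ k.+1) + v ^+ k.+1 / 2)); eexists; last reflexivity.
  by apply: lt_component; apply/andP; split; lra.
have /choice[s Ks] k : exists m, K k = component b w m.+1.
  apply: (trivIset_interval_partition_unique (b := b)) => //.
  - by move=> i; exact: component_image_closed_or_open.
  - by move=> i; exact: component_closed_or_open.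
  - exact: component_trivIset.
  - move=> i; apply/connected_intervalP/connected_continuous_connected => //.
    exact/connected_intervalP/interval_is_interval.
  - by move=> i; exact: interval_is_interval.
have injs : injective s.
  move=> i j sij; apply: tK => //; have [x Kx] := K0 i.
  by exists x; split=> //; rewrite Ks -sij -Ks.
(* The points at one and three quarters of the image component lie in it whether it is closed or
   open. They are half its length apart, and their preimages are at most [v ^+ k.+1] apart. *)
have growth k : w ^+ (s k).+1 / 2 <= 2 / d * v ^+ k.+1 + 1.
  set l := w ^+ (s k).+1; set L := 2 `^ l.
  have l0 : 0 < l by rewrite exprn_gt0//; lra.
  have [x Ix fx] : K k (L + l / 4).
    by rewrite Ks; apply: lt_component; apply/andP; split; rewrite -/l -/L; lra.
  have [y Iy fy] : K k (L + 3 * l / 4).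
    by rewrite Ks; apply: lt_component; apply/andP; split; rewrite -/l -/L; lra.
  have fxy : `|f x - f y| <= 2 / d * `|x - y| + 1.
    apply: (is_interval_lipschitz_large (I := component b v k.+1)) => //.
      exact: interval_is_interval.
    by move=> x' y' Ix' Iy'; apply: fd; exact: (subX k).
  have -> : l / 2 = `|f x - f y|.
    rewrite fx fy distrC ger0_norm; last by lra.
    by field.
  apply: (le_trans fxy); rewrite lerD2r ler_wpM2l// ?(ltW C0)//.
  have /andP[? ?] := component_le Ix; have /andP[? ?] := component_le Iy.
  by rewrite ler_norml; apply/andP; split; lra.
have v0 : 0 < v by lra.
(* The factor 2 clears the half in [growth]; the summand 1 there is absorbed using
   [1 <= v ^+ N.+1]. *)
have [N] := exprn_dominates (2 * (2 / d + 1)) v0 vw.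
have [n nN Ns] := injective_ge N injs.
have wN : w ^+ N.+1 <= w ^+ (s n).+1 by rewrite ler_weXn2l//; lra.
have vn : v ^+ n.+1 <= v ^+ N.+1 by rewrite ler_weXn2l//; lra.
have v1 : 1 <= v ^+ N.+1 by rewrite exprn_ege1//; lra.
have := growth n.
nra.
Qed.

Theorem proposition1 (R : realType) (v w : R) (hv : 2 <= v) (hvw : v < w) :
  ~ (exists f : R -> R, unif_continuous_bij (Xc v) (Xc w) f) /\
  ~ (exists f : R -> R, unif_continuous_bij (Xo v) (Xo w) f).
Proof.
have reindex (F : nat -> set R) : \bigcup_(n >= 1) F n = \bigcup_k F k.+1.
  apply/seteqP; split=> x.
    by case=> -[//|k] _ Fx; exists k.
  by case=> k _ Fx; exists k.+1.
have Xcb (u : R) : Xc u = \bigcup_k component true u k.+1 by rewrite -reindex.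
have Xob (u : R) : Xo u = \bigcup_k component false u k.+1 by rewrite -reindex.
by split=> -[f]; rewrite ?Xcb ?Xob; exact: no_unif_continuous_bij.
Qed.
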